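(* Let $f\colon\mathbb{R}\to\,]-\infty,+\infty]$ be convex, lower semicontinuous and proper, and suppose that $f$ is even, $f(0)=0$, $f(x)>0$ for all $x\neq 0$, and $f'(0)=0$. Let $A=\mathbb{R}\times\{0\}$, $B=\operatorname{epi} f=\{(x,r)\in\mathbb{R}^2 : f(x)\leq r\}$, and $T=\operatorname{Id}-P_A+P_BR_A$. Let $x_0>0$ with $x_0\in\operatorname{dom} f$, let $r_0=0$, $z_0=(x_0,r_0)$, and for every $n\in\mathbb{N}$ let $z_{n+1}=Tz_n=(x_{n+1},r_{n+1})$. Then $$x_n\downarrow 0\quad\text{and}\quad r_n\uparrow r_\infty\in\,]0,+\infty[,$$ and for every $n\in\mathbb{N}$ there exists $x_{n+1}^*\in\partial f(x_{n+1})$ such that $$0<x_{n+1}=x_n-r_{n+1}x_{n+1}^*<x_n\quad\text{and}\quad r_{n+1}=r_n+f(x_{n+1}).$$ Now suppose furthermore that $f''_+(0)$ exists in $[0,+\infty]$. Then $$\frac{x_{n+1}}{x_n}=\frac{1}{1+r_{n+1}\frac{x_{n+1}^*}{x_{n+1}}}\to\frac{1}{1+r_\infty f''_+(0)},$$ and exactly one of the following holds: (i) $f''_+(0)=+\infty$ and $x_n\to 0$ superlinearly. (ii) $f''_+(0)\in\,]0,+\infty[$ and $x_n\to 0$ linearly. (iii) $f''_+(0)=0$ and $x_n\to 0$ sublinearly. In this case, if there exists $q\in\mathbb{R}$ such that $$\lim_{x\downarrow 0}\frac{f'(x)}{x^q}=c\in\,]0,+\infty[,$$ then $x_n\to 0$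 logarithmically; moreover, if additionally $q>1$, then $$\frac{x_n}{\left(\frac1n\right)^{1/(q-1)}}\to\frac{1}{\big((q-1)r_\infty c\big)^{1/(q-1)}}.$$
   Context: $\mathbb{N}=\{0,1,2,\dots\}$. For a nonempty closed convex set $C\subseteq\mathbb{R}^2$, $P_C$ denotes the Euclidean nearest point projection onto $C$ and $R_C=2P_C-\operatorname{Id}$; $\operatorname{dom} f=\{x: f(x)<+\infty\}$; $\partial f$ is the convex subdifferential. The assumption that $f''_+(0)$ exists in $[0,+\infty]$ means that $f$ is differentiable on some interval $]0,\delta[$ with $\delta>0$ and that $f''_+(0)=\lim_{x\downarrow 0}\frac{f'(x)-f'(0)}{x}=\lim_{x\downarrow0}\frac{f'(x)}{x}$ exists in $[0,+\infty]$. The convention $1/(+\infty)=0$ is used. A sequence $(\alpha_n)$ of positive reals with $\alpha_n\to 0$ and $\alpha_{n+1}/\alpha_n\to c$ converges to $0$ superlinearly if $c=0$; linearly if $0<c<1$; sublinearly if $c=1$; and logarithmically if it converges sublinearly and $|\alpha_{n+1}-\alpha_{n+2}|/|\alpha_n-\alpha_{n+1}|\to 1$. *)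

(* Defs.v *)
From HB Require Import structures.
From mathcomp Require Import all_boot all_order all_algebra.
From mathcomp Require Import all_classical all_reals all_analysis.

Set Implicit Arguments.
Unset Strict Implicit.
Unset Printing Implicit Defensive.

Import Order.TTheory GRing.Theory Num.Theory.
Import numFieldNormedType.Exports.

Local Open Scope classical_set_scope.
Local Open Scope ring_scope.

Section Projections.
Context {R : realType}.
Implicit Types (C D : set (R * R)) (p q : R * R).

(* The library norm on [R * R] is the sup norm, hence this definition. *)
Definition edist p q : R :=
  Num.sqrt ((p.1 - q.1) ^+ 2 + (p.2 - q.2) ^+ 2).

Definition nearest_point C p : set (R * R) :=
  [set q | C q /\ forall c, C c -> edist p q <= edist p c].

(* When [C] is nonempty, closed and convex, the nearest point exists and is
   unique; the default value [p] is returned only if there is none. *)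
Definition proj C p : R * R := xget p (nearest_point C p).

Definition reflector C p : R * R := proj C p *+ 2 - p.

(* Douglas-Rachford operator Id - P_C + P_D R_C *)
Definition DR C D p : R * R := p - proj C p + proj D (reflector C p).

End Projections.

Section ExtendedValuedFunctions.
Context {R : realType}.
Implicit Types (f : R -> \bar R) (x a u : R).

Definition edom f : set R := [set x | (f x < +oo)%E].

Definition epi f : set (R * R) := [set p | (f p.1 <= p.2%:E)%E].

(* Only meant for functions that do not take the value -oo, since
   [+oo + -oo = -oo] in [\bar R]. *)
Definition econvex f := forall x y t, 0 < t < 1 ->
  (f (t * x + (1 - t) * y)%R <= t%:E * f x + (1 - t)%:E * f y)%E.

Definition eproper f :=
  (forall x, (-oo < f x)%E) /\ exists x, edom f x.

Definition subdiff f x : set R :=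
  [set u | forall y, (f x + (u * (y - x))%:E <= f y)%E].

(* [fine] sends +oo to 0, so finiteness near the point must be required. *)
Definition ediff f x :=
  (\forall y \near x, f y \is a fin_num) /\ derivable (fine \o f) x 1.

Definition ederive f x : R := (fine \o f)^`()%classic x.

Definition is_rderive2 f a (l : \bar R) :=
  (exists2 d : R, 0 < d & forall x, a < x < a + d -> ediff f x) /\
  ((ederive f x - ederive f a) / (x - a))%:E @[x --> a^'+] --> l.

End ExtendedValuedFunctions.

Section ConvergenceRates.
Context {R : realType}.
Implicit Types (u : R^nat) (c : R).

Definition cvg0_ratio u c :=
  [/\ forall n, 0 < u n, u @ \oo --> 0 &
      u n.+1 / u n @[n --> \oo] --> c].

Definition superlinearly u := cvg0_ratio u 0.

Definition linearly u := exists2 c, 0 < c < 1 & cvg0_ratio u c.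

Definition sublinearly u := cvg0_ratio u 1.

Definition logarithmically u := sublinearly u /\
  `|u n.+1 - u n.+2| / `|u n - u n.+1| @[n --> \oo] --> (1 : R).

End ConvergenceRates.

Definition exactly_one3 (P Q S : Prop) :=
  [\/ [/\ P, ~ Q & ~ S], [/\ ~ P, Q & ~ S] | [/\ ~ P, ~ Q & S]].

(* Main.v *)
From Pilot Require Import Defs.
From HB Require Import structures.
From mathcomp Require Import all_boot all_order all_algebra.
From mathcomp Require Import all_classical all_reals all_analysis.
From mathcomp Require Import ring lra.

Set Implicit Arguments.
Unset Strict Implicit.

Import Order.TTheory GRing.Theory Num.Theory.
Import numFieldNormedType.Exports.
(* From here on, [edist] and [proj] are the Euclidean distance and projection. *)
Import Pilot.Defs.

Local Open Scope classical_set_scope.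
Local Open Scope ring_scope.

(** Reflecting (x, r) in the horizontal axis and projecting onto the epigraph
    shows that one step of the iteration is
      (x', r') = (p, r + v), where (p, v) is the projection of (x, -r) onto epi f.
    Everything about a step follows from the variational inequality of that
    projection, which on points (y, f y) of the graph reads
      (x - p) (y - p) <= (r + v) (f y - f p).
    Once v = f p is known, this says that (x - p) / r' is a subgradient of f at
    p; taking y = 0 bounds (x - p) p below by r' f p, whence 0 < p < x as soon
    as p is nonzero; and p = 0 would force x y <= r f y for all y, against
    f'(0) = 0 (lemma [proj_epi_from_below]).

    The subgradient inequality at 0 also gives f(x_{n+1}) <= x_{n+1} x*_{n+1}, so
    the increments r_{n+1} - r_n = f(x_{n+1}) are at most K (x_n - x_{n+1}) with
    K = x_0 / r_1. Hence r_n + K x_n is nonincreasing and r is bounded. Its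
    increments therefore tend to 0, and since f is nondecreasing on the
    nonnegative half-line a positive limit L of x would keep them above f(L) > 0.

    The rates depend only on x_n = x_{n+1} + r_{n+1} x*_{n+1}. Dividing by x_n
    gives the formula for x_{n+1} / x_n; near 0 the subgradient is f', so
    x*_n / x_n tends to the second derivative and the three cases follow. If x
    is sublinear and x*_n is equivalent to c x_n^q, the ratio of consecutive
    differences tends to 1.
    For q > 1 one has moreover
      x_{n+1}^(1-q) - x_n^(1-q) = x_{n+1}^(1-q) (1 - rho^(q-1)),
    with rho = x_{n+1} / x_n, which tends to (q - 1) roo c because the derivative
    of t^(q-1) at 1 is q - 1. By Cesaro's theorem x_n^(1-q) is equivalent to
    (q - 1) roo c n, which is the announced asymptotics. *)

(** * Nearest points in the plane *)

Lemma edist_le (R : realType) (p q c : R * R) :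
  (edist p q <= edist p c) =
  ((p.1 - q.1) ^+ 2 + (p.2 - q.2) ^+ 2 <= (p.1 - c.1) ^+ 2 + (p.2 - c.2) ^+ 2).
Proof. by rewrite /edist ler_sqrt// addr_ge0// sqr_ge0. Qed.

Lemma proj_horizontal_axis (R : realType) (p : R * R) :
  proj ([set: R] `*` [set 0]) p = (p.1, 0).
Proof.
rewrite /proj; case: xgetP => [[a b] _ [[_ /= b0]]|] /=.
  move/(_ (p.1, 0)); rewrite edist_le /= b0 => /(_ (conj I erefl)) h.
  congr (_, _); apply/esym/eqP; rewrite -subr_eq0 -sqrf_eq0 eq_le sqr_ge0 andbT.
  by move: h; rewrite lerD2r subrr expr0n.
move=> /(_ (p.1, 0)) []; split => //= -[a b] [_ /= ->].
by rewrite edist_le /= lerD2r subrr expr0n /= sqr_ge0.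
Qed.

Lemma DR_horizontal_axisE (R : realType) (D : set (R * R)) (a s : R) :
  DR ([set: R] `*` [set 0]) D (a, s) =
  ((proj D (a, - s)).1, s + (proj D (a, - s)).2).
Proof.
rewrite /DR /reflector proj_horizontal_axis /=.
have -> : (a, 0) *+ 2 - (a, s) = (a, - s) :> R * R.
  by rewrite mulr2n; apply/pair_eqP; rewrite /= addrK addr0 sub0r !eqxx.
case: (proj D _) => u v; apply/pair_eqP.
by rewrite /= subrr add0r subr0 !eqxx.
Qed.

(** Only the part of C within distance edist p c0 of p matters, for some c0 in C;
    it is contained in a square, hence compact. *)
Lemma nearest_point_exists (R : realType) (C : set (R * R)) (p : R * R) :
  closed C -> C !=set0 -> exists q, nearest_point C p q.
Proof.
move=> clC [c0 Cc0].
pose d := edist p c0.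
have d0 : 0 <= d by exact: sqrtr_ge0.
pose K := (`[p.1 - d, p.1 + d] `*` `[p.2 - d, p.2 + d]) `&` C.
have inK c : C c -> edist p c <= d -> K c.
  move=> Cc pc; split; last by [].
  have h : (p.1 - c.1) ^+ 2 + (p.2 - c.2) ^+ 2 <= d ^+ 2.
    by rewrite -(sqr_sqrtr (_ : 0 <= _ + _)) ?addr_ge0 ?sqr_ge0// ler_sqr
       ?nnegrE ?sqrtr_ge0.
  have side u v : u ^+ 2 + v ^+ 2 <= d ^+ 2 -> `|u| <= d.
    move=> uvd; rewrite -ler_sqr ?nnegrE ?normr_ge0// real_normK ?num_real//.
    by apply: le_trans uvd; rewrite lerDl sqr_ge0.
  split; rewrite /= in_itv/= -ler_distlC.
    exact: side _ _ h.
  by move: h; rewrite addrC; exact: side.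
have K0 : K !=set0 by exists c0; exact: inK.
have cK : compact K.
  by apply: compact_closedI => //; apply: compact_setX; exact: segment_compact.
have cd : continuous (edist p).
  move=> c; apply: continuous_comp; last exact: sqrt_continuous.
  by apply: cvgD; apply: cvgM; apply: cvgB; (try exact: cvg_cst);
    (try exact: cvg_fst); exact: cvg_snd.
have [q qK qmin] := compact_EVT_min K0 cK (continuous_subspaceT cd).
exists q; split; first by move: qK; rewrite inE => -[].
move=> c Cc; have [dc|/ltW dc] := leP (edist p c) d.
  by apply: qmin; rewrite inE; exact: inK.
by apply: le_trans dc; apply: qmin; rewrite inE; apply: inK.
Qed.

(** Moving from q towards c by a fraction t changes the squared distance to p by
    -2 t I + t^2 N, where I is the inner product and N = |c - q|^2. If I > 0, this
    is negative for small t, e.g. for t = I / (2 I + N). Convexity is asked only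
    of the segment [q, c]. *)
Lemma nearest_point_variational (R : realType) (C : set (R * R)) (p q c : R * R) :
  (forall t, 0 < t < 1 ->
     C (t * c.1 + (1 - t) * q.1, t * c.2 + (1 - t) * q.2)) ->
  nearest_point C p q ->
  (p.1 - q.1) * (c.1 - q.1) + (p.2 - q.2) * (c.2 - q.2) <= 0.
Proof.
move=> segC [Cq qmin]; rewrite leNgt; apply/negP.
set I := (X in 0 < X); move=> I0.
set N := (c.1 - q.1) ^+ 2 + (c.2 - q.2) ^+ 2.
have N0 : 0 <= N by rewrite addr_ge0// sqr_ge0.
have M0 : 0 < 2 * I + N by lra.
pose t := I / (2 * I + N).
have tM : t * (2 * I + N) = I by rewrite /t mulfVK// gt_eqF.
have t0 : 0 < t by rewrite divr_gt0.
have t1 : t < 1 by rewrite /t ltr_pdivrMr//; lra.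
have := qmin _ (segC t _); rewrite t0 t1 edist_le/= => /(_ isT) h.
have {h} : 2 * I <= t * N.
  rewrite -(ler_pM2l t0) -subr_ge0; move: h; rewrite -subr_ge0.
  by congr (0 <= _); rewrite /I /N; ring.
nra.
Qed.

Lemma closed_epi (R : realType) (f : R -> \bar R) :
  lower_semicontinuous f -> closed (epi f).
Proof.
move=> lscf; rewrite -openC openE => -[a s] /= /negP.
rewrite -ltNge /= => sfa.
have [b sb bfa] : exists2 b : R, s < b & (b%:E < f a)%E.
  case: (f a) sfa => [v||] // sv.
    by exists ((s + v) / 2); rewrite ?lte_fin; move: sv; rewrite lte_fin; lra.
  by exists (s + 1); rewrite ?ltrDl// ltry.
have [V Va Vf] := lscf _ _ bfa.
exists (V, [set t | t < b]) => /=.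
  by split => //=; exact: lt_nbhsl.
move=> [u v] [/= Vu vb]; rewrite /epi /=; apply/negP; rewrite -ltNge.
by apply: lt_trans (Vf _ Vu); rewrite lte_fin.
Qed.

(** * Derivatives and subgradients *)

Lemma derivable_difference_quotient (R : realType) (g : R -> R) (p : R) :
  derivable g p 1 ->
  h^-1 * (g (p + h) - g p) @[h --> 0^'] --> (g^`()%classic p : R).
Proof.
move=> dg; rewrite derive1E.
have -> : (fun h => h^-1 * (g (p + h) - g p)) =
          (fun h => h^-1 *: ((g \o shift p) (h *: 1) - g p)).
  by apply/funext => h /=; rewrite [h *: 1]mulr1 [h + p]addrC.
exact: dg.
Qed.

(** The slopes f(p + h) - f(p) over h are at least u for h > 0 and at most u for
    h < 0, so both one-sided limits of the difference quotient pin u down. *)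
Lemma subdiff_ederive (R : realType) (f : R -> \bar R) (p u : R) :
  ediff f p -> subdiff f p u -> u = ederive f p.
Proof.
move=> [finp /derivable_difference_quotient]; rewrite -/(ederive f p) => cv su.
have fp : f p \is a fin_num by exact: nbhs_singleton finp.
have slope h : f (p + h) \is a fin_num ->
    u * h <= fine (f (p + h)) - fine (f p).
  move=> fh; have := su (p + h); rewrite -(fineK fp) -(fineK fh) -EFinD lee_fin.
  by rewrite addrAC subrr add0r lerBrDl.
have fin0 : \forall h \near 0, f (p + h) \is a fin_num.
  have cvp : p + h @[h --> (0 : R)] --> p.
    by rewrite -[X in _ --> X]addr0; apply: cvgD; [exact: cvg_cst|exact: cvg_id].
  exact: cvp finp.
apply/eqP; rewrite eq_le; apply/andP; split.
  apply: cvgr_to_ge (cvg_dnbhs_at_right cv) _.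
  near=> h; have h0 : 0 < h by [].
  rewrite -(ler_pM2l h0) mulVKf ?gt_eqF// mulrC; apply: slope.
  by near: h; apply: cvg_within.
apply: cvgr_to_le (cvg_dnbhs_at_left cv) _.
near=> h; have h0 : h < 0 by [].
rewrite -(ler_nM2l h0) mulVKf ?lt_eqF// mulrC; apply: slope.
by near: h; apply: cvg_within.
Unshelve. all: by end_near. Qed.

(** The form in which the hypothesis f'(0) = 0 is used: the graph of f comes
    under every line of positive slope through the origin. *)
Lemma flat_at_zero (R : realType) (f : R -> \bar R) : f 0 = 0%E ->
  ediff f 0 -> ederive f 0 = 0 ->
  forall e, 0 < e -> exists h, [/\ 0 < h, f h \is a fin_num & fine (f h) < e * h].
Proof.
move=> f0 [fin0 /derivable_difference_quotient].
rewrite -/(ederive f 0) => + d0 e e0; rewrite d0 => /cvg_dnbhs_at_right cv.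
have lte : \forall h \near 0^'+, h^-1 * fine (f h) < e.
  apply: filterS (cvgr_lt _ cv _ e0) => h.
  by rewrite /= add0r f0 subr0.
near (0 : R)^'+ => h.
have h0 : 0 < h by [].
exists h; split => //; first by near: h; apply: cvg_within.
rewrite mulrC -ltr_pdivrMl//.
by near: h; exact: lte.
Unshelve. all: by end_near. Qed.

(** * One step of the iteration *)

Section OneStep.
Context {R : realType} (f : R -> \bar R).
Hypotheses (f_convex : econvex f) (f_lsc : lower_semicontinuous f)
  (f0 : f 0 = 0%E) (f_gt0 : forall x, x != 0 -> (0 < f x)%E).

Let f_ge0 y : (0 <= f y)%E.
Proof. by have [->|/f_gt0/ltW//] := eqVneq y 0; rewrite f0. Qed.

(** As f is minimal at 0, convexity on [0, b] makes f nondecreasing. *)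
Lemma convex_ge0_le a b : 0 <= a <= b -> (f a <= f b)%E.
Proof.
move=> /andP[a0]; rewrite le_eqVlt => /orP[/eqP->//|ab].
move: a0; rewrite le_eqVlt => /orP[/eqP<-|a0]; first by rewrite f0.
have b0 : 0 < b by apply: lt_trans ab.
have t01 : 0 < a / b < 1 by rewrite divr_gt0// ltr_pdivrMr// mul1r.
have := f_convex b 0 t01.
rewrite mulr0 addr0 mulfVK ?gt_eqF// f0 mule0 adde0 => /le_trans; apply.
have [_ /ltW t1] := andP t01.
by rewrite -{2}[f b]mul1e lee_pmul// ?lee_fin// divr_ge0 ?ltW.
Qed.

Lemma epi_segment (c q : R * R) : epi f c -> epi f q -> forall t, 0 < t < 1 ->
  epi f (t * c.1 + (1 - t) * q.1, t * c.2 + (1 - t) * q.2).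
Proof.
rewrite /epi /= => fc fq t t01; have [t0 t1] := andP t01.
apply: le_trans (f_convex _ _ t01) _.
rewrite [leRHS]EFinD [X in (_ <= X + _)%E]EFinM [X in (_ <= _ + X)%E]EFinM.
rewrite leeD// lee_pmul2l ?lte_fin//.
by rewrite subr_gt0.
Qed.

(** The point (a, -s) lies below the epigraph and off the vertical axis, so its
    projection is a point of the graph strictly between the axis and a, and the
    connecting segment is normal to the epigraph there. This is the content of
    one Douglas-Rachford step. *)
Lemma proj_epi_from_below (a s : R) : 0 < a -> 0 <= s ->
  ediff f 0 -> ederive f 0 = 0 ->
  let q := proj (epi f) (a, - s) in
  [/\ q.2%:E = f q.1, 0 < q.2, 0 < q.1 < a &
      subdiff f q.1 ((a - q.1) / (s + q.2))].
Proof.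
move=> a0 s0 d0 fd0 /=.
have npq : nearest_point (epi f) (a, - s) (proj (epi f) (a, - s)).
  rewrite /proj; case: xgetP => // noq.
  have [|q /noq//] := @nearest_point_exists R (epi f) (a, - s) (closed_epi f_lsc).
  by exists (0, 0); rewrite /epi /= f0.
move: (proj _ _) npq => [p v] npq /=.
have epiq : epi f (p, v) by case: npq.
have fp : f p \is a fin_num.
  by rewrite ge0_fin_numE//; apply: le_lt_trans epiq _; rewrite ltry.
have fpv : fine (f p) <= v by rewrite -lee_fin fineK.
have fp0 : 0 <= fine (f p) by exact: fine_ge0.
have vi y w : (f y <= w%:E)%E -> (a - p) * (y - p) <= (s + v) * (w - v).
  move=> fyw.
  have := nearest_point_variational (epi_segment (c := (y, w)) fyw epiq) npq.
  by rewrite /=; lra.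
(* Otherwise the point (p, f p) vertically below (p, v) would be nearer. *)
have vE : v = fine (f p).
  apply/eqP; rewrite eq_le fpv andbT leNgt; apply/negP => lt.
  have := vi p (fine (f p)); rewrite fineK// lexx subrr mulr0 => /(_ isT).
  by nra.
(* If p = 0, then v = 0 and the variational inequality becomes a y <= s (f y) for
   all y, which fails where f y < a y / (s + 1). *)
have p_neq0 : p != 0.
  apply/eqP => p0; move: vE; rewrite p0 f0 /= => v0.
  have e0 : 0 < a / (s + 1) by rewrite divr_gt0//; lra.
  have [h [h0 fh fhe]] := flat_at_zero f0 d0 fd0 e0.
  have := vi h (fine (f h)); rewrite fineK// lexx => /(_ isT).
  rewrite p0 v0 addr0 !subr0 => vih.
  have : (s + 1) * fine (f h) < a * h.
    by rewrite -ltr_pdivlMl; [move: fhe; rewrite mulrA [_^-1 * _]mulrC | lra].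
  have := fine_ge0 (f_ge0 h); lra.
have v0 : 0 < v by rewrite vE fine_gt0// f_gt0//= -ge0_fin_numE.
(* The variational inequality at the vertex (0, 0) of the epigraph. *)
have vi0 : (s + v) * v <= (a - p) * p.
  by have := vi 0 0; rewrite f0 lexx => /(_ isT); lra.
have sv0 : 0 < s + v by lra.
split => //.
- by rewrite vE fineK.
- by apply/andP; split; nra.
- move=> y; have [fy|] := boolP (f y < +oo)%E; last first.
    by rewrite -leNgt leye_eq => /eqP ->; rewrite leey.
  have fyf : f y \is a fin_num by rewrite ge0_fin_numE.
  rewrite -(fineK fyf) -(fineK fp) -EFinD lee_fin -lerBrDl.
  rewrite mulrAC ler_pdivrMr// [leRHS]mulrC -vE; apply: vi.
  by rewrite fineK.
Qed.

End OneStep.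

(** * Sequences *)

Lemma cvg_EFinP (R : realType) (u : R^nat) (l : R) :
  (u n)%:E @[n --> \oo] --> l%:E <-> u @ \oo --> l.
Proof.
by split=> [/fine_cvgP[]//|ul]; apply/fine_cvgP; split => //; exact: nearW.
Qed.

Lemma powRV (R : realType) (a q : R) : 0 <= a -> a^-1 `^ q = a `^ (- q).
Proof. by move=> a0; rewrite -powR_inv1// -powRrM mulN1r. Qed.

Lemma cvg_powR (R : realType) (u : R^nat) (a q : R) : 0 < a ->
  u @ \oo --> a -> u n `^ q @[n --> \oo] --> a `^ q.
Proof.
move=> a0 ua; have [da _] := is_derive1_powR q a0.
apply: (cvg_comp u (fun t => t `^ q) ua).
by move/derivable1_diffP/differentiable_continuous: da.
Qed.

Lemma cvg_at_right_seq (R : realType) (u : R^nat) (a : R) :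
  (forall n, a < u n) -> u @ \oo --> a -> u @ \oo --> a^'+.
Proof.
move=> au ua P; rewrite /at_right /within /= => aP.
have h : \forall n \near \oo, a < u n -> P (u n) by exact: (ua _ aP).
by apply: filterS h => n; apply; exact: au.
Qed.

(** * Rates of convergence of x_{n+1} = x_n - r_{n+1} s_{n+1} *)

Section Rates.
Context {R : realType} (x r s : R^nat) (roo : R).
Hypotheses (x_gt0 : forall n, 0 < x n)
  (x_rec : forall n, x n.+1 = x n - r n.+1 * s n.+1)
  (x_dec : forall n, x n.+1 < x n)
  (r_gt0 : forall n, 0 < r n.+1)
  (x_cvg0 : x @ \oo --> (0 : R)) (r_cvg : r @ \oo --> roo) (roo_gt0 : 0 < roo).

Let r_cvgS : r n.+1 @[n --> \oo] --> roo.
Proof. by move: r_cvg; rewrite -cvg_shiftS. Qed.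

Let s_gt0 n : 0 < s n.+1.
Proof.
by have := x_dec n; rewrite x_rec gtrBl pmulr_rgt0.
Qed.

Lemma consecutive_ratioE n : x n.+1 / x n = 1 / (1 + r n.+1 * (s n.+1 / x n.+1)).
Proof.
have -> : x n = x n.+1 + r n.+1 * s n.+1 by rewrite x_rec subrK.
have xn := x_gt0 n.+1; have rs : 0 < r n.+1 * s n.+1 by rewrite mulr_gt0.
by field; rewrite !gt_eqF//= addr_gt0.
Qed.

(** For l = +oo the limit is 1 / +oo = 0; it is obtained from r_n >= roo / 2 for
    large n. *)
Lemma consecutive_ratio_cvg (l : \bar R) : (0 <= l)%E ->
  (s n.+1 / x n.+1)%:E @[n --> \oo] --> l ->
  (x n.+1 / x n)%:E @[n --> \oo] --> (1 / (1 + roo%:E * l))%E.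
Proof.
under [X in _ -> _ -> X @ _ --> _]eq_fun do rewrite consecutive_ratioE div1r.
case: l => [l|_|//].
  rewrite lee_fin => l0 /cvg_EFinP slx.
  have d0 : 1 + roo * l != 0 by rewrite gt_eqF// ltr_pwDl// mulr_ge0// ltW.
  rewrite -EFinM -EFinD mul1e inver (negPf d0); apply/cvg_EFinP.
  apply: cvgV => //; apply: cvgD; first exact: cvg_cst.
  exact: cvgM.
move=> /cvgeryP slx.
rewrite gt0_muley ?lte_fin// addey// invey mule0; apply/cvg_EFinP.
apply/gtr0_cvgV0.
  by apply: nearW => n; rewrite addr_gt0// mulr_gt0// divr_gt0.
have half : \forall n \near \oo, roo / 2 <= r n.+1.
  apply: (cvgr_ge _ r_cvgS); rewrite ltr_pdivrMr//.
  by rewrite mulr_natr mulr2n ltrDl.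
apply/cvgryPge => A.
move/cvgryPge : slx => /(_ (A / (roo / 2))).
apply: filterS2 half => n rn sn.
rewrite -[A]add0r lerD//.
move: sn; rewrite ler_pdivrMr ?divr_gt0// => /le_trans; apply.
by rewrite mulrC ler_wpM2r// divr_ge0// ltW.
Qed.

Lemma cvg0_ratio_fin (l : R) : 0 <= l ->
  (s n.+1 / x n.+1)%:E @[n --> \oo] --> l%:E ->
  cvg0_ratio x (1 / (1 + roo * l)).
Proof.
move=> l0 /consecutive_ratio_cvg; rewrite lee_fin => /(_ l0).
have d0 : 1 + roo * l != 0 by rewrite gt_eqF// ltr_pwDl// mulr_ge0// ltW.
by rewrite -EFinM -EFinD inver (negPf d0) -EFinM => /cvg_EFinP.
Qed.

(** The value of l determines the limit of the ratios: 0, a number strictly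
    between 0 and 1, or 1. The proposition P stands for whatever else is claimed
    in the sublinear case; since the other two cases exclude l = 0, it may be
    proved under the assumptions of that case. *)
Lemma rate_trichotomy (l : \bar R) : (0 <= l)%E ->
  (s n.+1 / x n.+1)%:E @[n --> \oo] --> l ->
  forall P : Prop, (l = 0%E -> sublinearly x -> P) ->
  exactly_one3 (l = +oo%E /\ superlinearly x)
               ((0 < l < +oo)%E /\ linearly x)
               [/\ l = 0%E, sublinearly x & P].
Proof.
move=> l0 sl P HP; case: l l0 sl HP => [l||//].
  rewrite lee_fin le_eqVlt => /orP[/eqP<-|l0] sl HP.
    have sub : sublinearly x.
      by have := cvg0_ratio_fin (lexx 0) sl; rewrite mulr0 addr0 divr1.
    apply: Or33; split => //; first by case.
      by rewrite ltxx => -[].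
    by split => //; exact: HP.
  apply: Or32; split; first by case.
    split; first by rewrite lte_fin l0 ltry.
    exists (1 / (1 + roo * l)); last by apply: cvg0_ratio_fin => //; exact: ltW.
    have rl : 0 < roo * l by rewrite mulr_gt0.
    by rewrite divr_gt0 ?addr_gt0//= ltr_pdivrMr ?addr_gt0// mul1r ltrDl.
  by case=> -[l0']; rewrite l0' ltxx in l0.
move=> _ sl HP; apply: Or31; split; last by case.
  split => //; split => //; have := consecutive_ratio_cvg (leey _) sl.
  by rewrite gt0_muley ?lte_fin// addey// invey mule0 => /cvg_EFinP.
by case=> /andP[].
Qed.

Section PowerGrowth.
Variables (q c : R).
Hypotheses (c_gt0 : 0 < c) (sub : sublinearly x)
  (sq : s n.+1 / x n.+1 `^ q @[n --> \oo] --> c).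

Let ratio1 : x n.+1 / x n @[n --> \oo] --> (1 : R).
Proof. by case: sub. Qed.

(** Differences of x are r_{n+1} s_{n+1}, and s_{n+1} is equivalent to
    c x_{n+1}^q, so a ratio of consecutive differences is asymptotic to the qth
    power of a ratio of consecutive terms of x. *)
Lemma sublinear_logarithmic : logarithmically x.
Proof.
split => //.
pose w n := s n.+1 / x n.+1 `^ q.
have -> : (fun n => `|x n.+1 - x n.+2| / `|x n - x n.+1|) =
    (fun n => (r n.+2 / r n.+1) * ((w n.+1 / w n) * (x n.+2 / x n.+1) `^ q)).
  apply/funext => n.
  have step m : `|x m - x m.+1| = r m.+1 * s m.+1.
    by rewrite x_rec opprB addrC subrK gtr0_norm// mulr_gt0.
  rewrite !step /w powRM ?invr_ge0 ?ltW// powRV ?ltW// powRN.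
  have := s_gt0 n; have := r_gt0 n.
  have := powR_gt0 q (x_gt0 n.+1); have := powR_gt0 q (x_gt0 n.+2).
  by move=> ? ? ? ?; field; rewrite !gt_eqF.
have r2 : r n.+2 @[n --> \oo] --> roo.
  by move: r_cvgS; rewrite -(cvg_shiftS (fun n => r n.+1)).
have w2 : w n.+1 @[n --> \oo] --> c by move: sq; rewrite -(cvg_shiftS w).
have x2 : x n.+2 / x n.+1 @[n --> \oo] --> (1 : R).
  by move: ratio1; rewrite -(cvg_shiftS (fun n => x n.+1 / x n)).
have -> : (1 : R) = roo / roo * (c / c * 1 `^ q).
  by rewrite powR1 !divff ?gt_eqF// !mulr1.
apply: cvgM; first by apply: cvgM => //; apply: cvgV => //; rewrite gt_eqF.
apply: cvgM; first by apply: cvgM => //; apply: cvgV => //; rewrite gt_eqF.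
exact: cvg_powR.
Qed.

Hypothesis q_gt1 : 1 < q.

(** With rho = x_{n+1} / x_n and w = s_{n+1} / x_{n+1}^q, the recursion gives
    1 - rho = r_{n+1} w rho x_{n+1}^(q-1), so that the increment is
    r_{n+1} w rho times the difference quotient of t^(q-1) between rho and 1. *)
Lemma power_increments :
  x n.+1 `^ (1 - q) - x n `^ (1 - q) @[n --> \oo] --> (q - 1) * roo * c.
Proof.
pose w n := s n.+1 / x n.+1 `^ q.
pose rho n := x n.+1 / x n.
have rho_gt0 n : 0 < rho n by rewrite divr_gt0.
have rho_lt1 n : rho n < 1 by rewrite ltr_pdivrMr// mul1r.
pose dq t := (t - 1)^-1 * (t `^ (q - 1) - 1).
have -> : (fun n => x n.+1 `^ (1 - q) - x n `^ (1 - q)) =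
    (fun n => dq (rho n) * (r n.+1 * w n * rho n)).
  apply/funext => n.
  have xx : x n = x n.+1 / rho n.
    by rewrite /rho invf_div mulrCA divff ?mulr1// gt_eqF.
  have yE : x n `^ (1 - q) = x n.+1 `^ (1 - q) * rho n `^ (q - 1).
    by rewrite [in LHS]xx powRM ?invr_ge0 ?ltW// powRV ?ltW// opprB.
  have rwE : r n.+1 * w n * rho n = (1 - rho n) * x n.+1 `^ (1 - q).
    have -> : 1 - rho n = r n.+1 * s n.+1 / x n.
      have -> : r n.+1 * s n.+1 = x n - x n.+1.
        by rewrite x_rec opprB addrC subrK.
      by rewrite mulrBl divff ?gt_eqF.
    rewrite powRB; last by rewrite (gt_eqF (x_gt0 n.+1)) implybT.
    rewrite powRr1 ?ltW// /w /rho.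
    have := powR_gt0 q (x_gt0 n.+1); have := x_gt0 n.
    by move=> ? ?; field; rewrite !gt_eqF.
  rewrite rwE yE /dq; field.
  by rewrite subr_eq0 lt_eqF.
have dcv : dq (rho n) @[n --> \oo] --> (q - 1 : R).
  have [da d1] := is_derive1_powR (q - 1) (@ltr01 R).
  have := derivable_difference_quotient da.
  rewrite derive1E d1 powR1 mulr1 => /cvg_dnbhs_at_left cv.
  have rho1 : rho n - 1 @[n --> \oo] --> 0^'-.
    move=> P; rewrite /at_left /within /= => aP.
    have rho1 : rho n - 1 @[n --> \oo] --> (0 : R).
      by rewrite -(subrr 1); apply: cvgB => //; exact: cvg_cst.
    have h : \forall n \near \oo, rho n - 1 < 0 -> P (rho n - 1).
      exact: rho1 aP.
    by apply: filterS h => n; apply; rewrite subr_lt0.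
  have := cvg_comp _ _ rho1 cv; apply: cvg_trans; apply: near_eq_cvg.
  by apply: nearW => n; rewrite /= /dq addrCA subrr addr0.
have -> : (q - 1) * roo * c = (q - 1) * (roo * c * 1) by rewrite mulr1 mulrA.
by apply: cvgM => //; apply: cvgM => //; exact: cvgM.
Qed.

(** The increments of y_n = x_n^(1-q) converge, so y_n / n converges to the same
    limit L by Cesaro's theorem; then take the power -1/(q-1). *)
Lemma power_asymptotics :
  x n / (1 / n%:R) `^ (1 / (q - 1)) @[n --> \oo] -->
  1 / ((q - 1) * roo * c) `^ (1 / (q - 1)).
Proof.
pose L := (q - 1) * roo * c.
have q1 : 0 < q - 1 by rewrite subr_gt0.
have L0 : 0 < L by rewrite !mulr_gt0.
pose y n := x n `^ (1 - q).
have yn : y n.+1 / n.+1%:R @[n --> \oo] --> L.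
  have h := @cesaro R _ _ power_increments.
  have -> : (fun n => y n.+1 / n.+1%:R) =
     (fun n => arithmetic_mean (fun n => y n.+1 - y n) n + y 0%N * n.+1%:R^-1).
    apply/funext => n; rewrite /arithmetic_mean /=.
    have := eq_sum_telescope y n.+1; rewrite /telescope /= => {1}->.
    by rewrite mulrDl addrC mulrC.
  rewrite -[L]addr0 -[X in _ + X](mulr0 (y 0%N)); apply: cvgD => //.
  by apply: cvgM; [exact: cvg_cst|exact: cvg_harmonic].
(* The shift discards the term n = 0, where 1 / n = 0. *)
rewrite -/L -cvg_shiftS /=.
have -> : 1 / L `^ (1 / (q - 1)) = L `^ (- (1 / (q - 1))) by rewrite powRN div1r.
have -> : (fun n => x n.+1 / (1 / n.+1%:R) `^ (1 / (q - 1))) =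
          (fun n => (y n.+1 / n.+1%:R) `^ (- (1 / (q - 1)))).
  apply/funext => n; rewrite powRM ?powR_ge0 ?invr_ge0// /y -powRrM.
  have -> : (1 - q) * - (1 / (q - 1)) = 1 by field; rewrite gt_eqF.
  by rewrite powRr1 ?ltW// powRN div1r.
exact: cvg_powR.
Qed.

End PowerGrowth.
End Rates.

(** * The orbit *)

Section Orbit.
Context {R : realType} (f : R -> \bar R) (x r : R^nat).
Hypotheses (f_convex : econvex f) (f_lsc : lower_semicontinuous f)
  (f0 : f 0 = 0%E) (f_gt0 : forall y, y != 0 -> (0 < f y)%E)
  (f_diff0 : ediff f 0) (f'0 : ederive f 0 = 0)
  (x0_gt0 : 0 < x 0%N) (r0 : r 0%N = 0)
  (zS : forall n, (x n.+1, r n.+1) =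
                  DR ([set: R] `*` [set 0]) (epi f) (x n, r n)).

(** The subgradient of f at x_n produced by the projection. Only n > 0 is
    meaningful; at n = 0 the value is 0. *)
Definition orbit_slope n : R := (x n.-1 - x n) / r n.

Let step_of n : 0 < x n -> 0 <= r n ->
  [/\ (r n.+1)%:E = ((r n)%:E + f (x n.+1))%E, r n < r n.+1,
      0 < x n.+1 < x n & subdiff f (x n.+1) (orbit_slope n.+1)].
Proof.
move=> xn rn.
have [] := proj_epi_from_below f_convex f_lsc f0 f_gt0 xn rn f_diff0 f'0.
have := zS n; rewrite DR_horizontal_axisE => -[<- rS].
rewrite /orbit_slope rS /= => <- v0 xS su; split => //.
by rewrite ltrDl.
Qed.

Let orbit_inv n : 0 < x n /\ 0 <= r n.
Proof.
elim: n => [|n [xn rn]]; first by rewrite r0.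
have [_ rS /andP[xS _] _] := step_of xn rn.
by split => //; apply: ltW; apply: le_lt_trans rS.
Qed.

Lemma orbit_step n :
  [/\ (r n.+1)%:E = ((r n)%:E + f (x n.+1))%E, r n < r n.+1,
      0 < x n.+1 < x n & subdiff f (x n.+1) (orbit_slope n.+1)].
Proof. by have [xn rn] := orbit_inv n; exact: step_of. Qed.

Lemma orbit_gt0 n : 0 < x n.
Proof. by case: (orbit_inv n). Qed.

Let r_gt0 n : 0 < r n.+1.
Proof.
have [_ rn] := orbit_inv n; have [_ rS _ _] := orbit_step n.
exact: le_lt_trans rS.
Qed.

Lemma ordinate_nondecreasing : nondecreasing_seq r.
Proof.
by apply/nondecreasing_seqP => n; have [_ /ltW] := orbit_step n.
Qed.

Lemma abscissa_nonincreasing : nonincreasing_seq x.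
Proof.
by apply/nonincreasing_seqP => n; have [_ _ /andP[_ /ltW]] := orbit_step n.
Qed.

Let f_fin n : f (x n.+1) \is a fin_num.
Proof.
have [rE _ _ _] := orbit_step n.
have : ((r n)%:E + f (x n.+1))%E \is a fin_num by rewrite -rE.
by rewrite fin_numD => /andP[].
Qed.

Lemma ordinate_increment n : r n.+1 - r n = fine (f (x n.+1)).
Proof.
have [+ _ _ _] := orbit_step n.
by rewrite -(fineK (f_fin n)) -EFinD => -[->]; rewrite addrAC subrr add0r.
Qed.

Let K := x 0%N / r 1%N.

(** The subgradient inequality between x_{n+1} and 0 bounds f(x_{n+1}) by
    x_{n+1} (x_n - x_{n+1}) / r_{n+1}, where x_{n+1} <= x_0 and r_1 <= r_{n+1}. *)
Lemma ordinate_increment_le n : r n.+1 - r n <= K * (x n - x n.+1).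
Proof.
have [_ _ /andP[xS xn] /(_ 0)] := orbit_step n.
rewrite f0 -(fineK (f_fin n)) -ordinate_increment -EFinD lee_fin.
rewrite sub0r mulrN subr_le0 => /le_trans; apply.
rewrite /orbit_slope /= -mulrA mulrC; apply: ler_wpM2r.
  by rewrite subr_ge0 ltW.
rewrite mulrC; apply: ler_pM; rewrite ?invr_ge0 ?(ltW (r_gt0 _))//.
- exact: ltW.
- exact: abscissa_nonincreasing.
- by rewrite lef_pV2 ?posrE ?r_gt0//; exact: ordinate_nondecreasing.
Qed.

(** By the previous lemma, r + K x is nonincreasing. *)
Lemma ordinate_bounded n : r n <= K * x 0%N.
Proof.
have K0 : 0 <= K by rewrite divr_ge0 ?ltW// r_gt0.
suff h : r n + K * x n <= K * x 0%N.
  by apply: le_trans h; rewrite lerDl mulr_ge0// ltW// orbit_gt0.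
elim: n => [|n IH]; first by rewrite r0 add0r.
by have := ordinate_increment_le n; lra.
Qed.

Lemma ordinate_cvg : exists2 roo, r @ \oo --> roo & 0 < roo.
Proof.
exists (sup (range r)).
  apply: nondecreasing_cvgn ordinate_nondecreasing _.
  by exists (K * x 0%N) => _ [n _ <-]; exact: ordinate_bounded.
apply: lt_le_trans (r_gt0 0) _; apply: ub_le_sup; last by exists 1%N.
by exists (K * x 0%N) => _ [n _ <-]; exact: ordinate_bounded.
Qed.

(** If the limit L of x were positive, every increment f(x_{n+1}) of r would be
    at least f(L) > 0, whereas r converges. *)
Lemma abscissa_cvg0 : x @ \oo --> (0 : R).
Proof.
have cx : x @ \oo --> inf (range x).
  apply: nonincreasing_cvgn abscissa_nonincreasing _.
  by exists 0 => _ [n _ <-]; exact/ltW/orbit_gt0.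
suff -> : 0 = inf (range x) by [].
set L := inf _ in cx *.
have Lx n : L <= x n.
  apply: ge_inf; last by exists n.
  by exists 0 => _ [m _ <-]; exact/ltW/orbit_gt0.
have L0 : 0 <= L.
  by apply: (cvgr_to_ge cx); apply: nearW => n; exact/ltW/orbit_gt0.
apply/eqP; move: L0; rewrite le_eqVlt => /orP[//|L0].
have fL n : (f L <= f (x n))%E by apply: convex_ge0_le => //; rewrite ltW//=.
have fLf : f L \is a fin_num.
  rewrite ge0_fin_numE ?(le_lt_trans (fL 1%N)) ?ltey_eq ?f_fin//.
  by rewrite ltW// f_gt0// gt_eqF.
have fL0 : 0 < fine (f L).
  by rewrite -lte_fin fineK// f_gt0// gt_eqF.
have [roo rcv _] := ordinate_cvg.
have : fine (f L) <= roo - roo.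
  have rcvS : r n.+1 @[n --> \oo] --> roo by move: rcv; rewrite -cvg_shiftS.
  have dcv : r n.+1 - r n @[n --> \oo] --> roo - roo by exact: cvgB.
  apply: (cvgr_to_ge dcv); apply: nearW => n.
  by rewrite ordinate_increment fine_le.
by rewrite subrr leNgt fL0.
Qed.

Lemma orbit_slope_ederive d : 0 < d ->
  (forall y, 0 < y < d -> ediff f y) ->
  \forall n \near \oo, orbit_slope n.+1 = ederive f (x n.+1).
Proof.
move=> d0 fd.
have xd : \forall n \near \oo, x n.+1 < d.
  have xS : x n.+1 @[n --> \oo] --> (0 : R).
    by move: abscissa_cvg0; rewrite -cvg_shiftS.
  exact: (cvgr_lt _ xS).
apply: filterS xd => n xd; have [_ _ _] := orbit_step n.
by apply: subdiff_ederive; apply: fd; rewrite orbit_gt0.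
Qed.

End Orbit.

Unset Implicit Arguments.

(** * The theorem *)

Theorem theorem5p3 (R : realType) (f : R -> \bar R)
  (f_convex : econvex f) (f_lsc : lower_semicontinuous f) (f_proper : eproper f)
  (f_even : forall x, f (- x) = f x) (f0 : f 0 = 0%E)
  (f_gt0 : forall x, x != 0 -> (0 < f x)%E)
  (f_diff0 : ediff f 0) (f'0 : ederive f 0 = 0)
  (x0 : R) (x0_gt0 : 0 < x0) (x0_dom : edom f x0)
  (x r : R^nat) (z0E : (x 0%N, r 0%N) = (x0, 0))
  (zSE : forall n, (x n.+1, r n.+1) =
                   DR ([set: R] `*` [set 0]) (epi f) (x n, r n)) :
  exists (roo : R) (xs : R^nat),
    [/\ nonincreasing_seq x /\ x @ \oo --> 0,
        [/\ nondecreasing_seq r, r @ \oo --> roo & 0 < roo],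
        forall n, [/\ subdiff f (x n.+1) (xs n.+1),
                      0 < x n.+1,
                      x n.+1 = x n - r n.+1 * xs n.+1,
                      x n.+1 < x n &
                      (r n.+1)%:E = ((r n)%:E + f (x n.+1))%E]
      & forall f''0 : \bar R, (0 <= f''0)%E -> is_rderive2 f 0 f''0 ->
        [/\ forall n, x n.+1 / x n = 1 / (1 + r n.+1 * (xs n.+1 / x n.+1)),
            (x n.+1 / x n)%:E @[n --> \oo] --> (1 / (1 + roo%:E * f''0))%E
          & exactly_one3
              (f''0 = +oo%E /\ superlinearly x)
              ((0 < f''0 < +oo)%E /\ linearly x)
              [/\ f''0 = 0%E, sublinearly x
                & forall q c : R, 0 < c ->
                  ederive f t / t `^ q @[t --> 0^'+] --> c ->
                  logarithmically x /\
                  (1 < q ->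
                   x n / (1 / n%:R) `^ (1 / (q - 1)) @[n --> \oo] -->
                   1 / ((q - 1) * roo * c) `^ (1 / (q - 1)))]]].
Proof.
have [x0E r0E] : x 0%N = x0 /\ r 0%N = 0 by case: z0E.
have xp : 0 < x 0%N by rewrite x0E.
have step := orbit_step f_convex f_lsc f0 f_gt0 f_diff0 f'0 xp r0E zSE.
have xgt0 := orbit_gt0 f_convex f_lsc f0 f_gt0 f_diff0 f'0 xp r0E zSE.
have xni := abscissa_nonincreasing f_convex f_lsc f0 f_gt0 f_diff0 f'0 xp r0E zSE.
have rnd := ordinate_nondecreasing f_convex f_lsc f0 f_gt0 f_diff0 f'0 xp r0E zSE.
have xcv := abscissa_cvg0 f_convex f_lsc f0 f_gt0 f_diff0 f'0 xp r0E zSE.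
have [roo rcv roo0] := ordinate_cvg f_convex f_lsc f0 f_gt0 f_diff0 f'0 xp r0E zSE.
have sE := orbit_slope_ederive f_convex f_lsc f0 f_gt0 f_diff0 f'0 xp r0E zSE.
pose s := orbit_slope x r.
have r_gt0 n : 0 < r n.+1.
  have [_ rS _ _] := step n; apply: le_lt_trans rS.
  by rewrite -r0E; exact: rnd.
have x_rec n : x n.+1 = x n - r n.+1 * s n.+1.
  by rewrite /s /orbit_slope /= mulrC mulfVK ?gt_eqF// subKr.
have x_dec n : x n.+1 < x n by have [_ _ /andP[]] := step n.
have xSr : x n.+1 @[n --> \oo] --> (0 : R)^'+.
  by apply: cvg_at_right_seq => //; move: xcv; rewrite -cvg_shiftS.
exists roo, s; split => //.
  by move=> n; have [? ? ? ?] := step n; split.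
move=> f2 f2_ge0 [[d d0 fd] f2cv].
have {sE} sE := sE _ d0 _.
have {}sE : \forall n \near \oo, s n.+1 = ederive f (x n.+1).
  by apply: sE => y yd; apply: fd; rewrite add0r.
have sx : (s n.+1 / x n.+1)%:E @[n --> \oo] --> f2.
  have := cvg_comp _ _ xSr f2cv; apply: cvg_trans; apply: near_eq_cvg.
  by apply: filterS sE => n ->; rewrite /= f'0 !subr0.
split.
- exact: consecutive_ratioE.
- exact: (consecutive_ratio_cvg (s := s)).
- apply: (rate_trichotomy (s := s) (r := r) (roo := roo)) => //.
  move=> f20 sub q c c0 qcv.
  have sq : s n.+1 / x n.+1 `^ q @[n --> \oo] --> c.
    have := cvg_comp _ _ xSr qcv; apply: cvg_trans; apply: near_eq_cvg.
    by apply: filterS sE => n ->.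
  split.
    exact: (sublinear_logarithmic xgt0 x_rec x_dec r_gt0 rcv roo0 c0 sub sq).
  move=> q1.
  exact: (power_asymptotics xgt0 x_rec x_dec rcv roo0 c0 sub sq q1).
Qed.
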